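(* Up to isomorphism, the unique $2$-anti-transitive critical kernel imperfect digraph of diameter $2$ is $\overrightarrow{A}_3$, the directed cycle of length $3$.
   Context: All digraphs are finite, with no loops and no multiple arcs (a pair of opposite arcs is allowed). A kernel of $D$ is a set $K\subseteq V(D)$ that is independent (no arcs between its vertices) and absorbent (for every $u\in V(D)\setminus K$ there is $v\in K$ with $(u,v)\in A(D)$). $D$ is critical kernel imperfect if $D$ has no kernel but every proper induced subdigraph of $D$ has a kernel. A $k$-path is a directed path (distinct vertices) of length $k$. $D$ is $2$-anti-transitive if for every pair of distinct vertices $u,v$, the existence of a $2$-path from $u$ to $v$ implies $(u,v)\notin A(D)$. The diameter of $D$ is the maximum of the directed distances $d(u,v)$ over all ordered pairs of vertices. *)

(* Defs.v *)
From mathcomp Require Import all_boot.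

Set Implicit Arguments.
Unset Strict Implicit.
Unset Printing Implicit Defensive.

(* Arcs form a boolean relation, so there are no multiple arcs; opposite arcs
   [arc u v] and [arc v u] may coexist. *)
Record digraph := Digraph {
  vertex :> finType;
  arc : rel vertex;
  arc_irr : irreflexive arc
}.

Definition isomorphic (D E : digraph) : Prop :=
  exists f : D -> E,
    bijective f /\ forall x y : D, arc (f x) (f y) = arc x y.

Lemma induced_arc_irr (D : digraph) (S : {set D}) :
  irreflexive (fun x y : {x : D | x \in S} => arc (val x) (val y)).
Proof. by move=> x; apply: arc_irr. Qed.

Definition induced (D : digraph) (S : {set D}) : digraph :=
  Digraph (@induced_arc_irr D S).

Definition independent (D : digraph) (K : {set D}) : Prop :=
  forall u v : D, u \in K -> v \in K -> ~~ arc u v.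

Definition absorbent (D : digraph) (K : {set D}) : Prop :=
  forall u : D, u \notin K -> exists2 v : D, v \in K & arc u v.

Definition kernel (D : digraph) (K : {set D}) : Prop :=
  independent K /\ absorbent K.

Definition has_kernel (D : digraph) : Prop := exists K : {set D}, kernel K.

(* Subdigraphs on the empty vertex set are included; this is harmless, since
   the empty set is a kernel of the empty digraph. *)
Definition critical_kernel_imperfect (D : digraph) : Prop :=
  ~ has_kernel D /\
  forall S : {set D}, S \proper [set: D] -> has_kernel (induced S).

(* A directed path is the sequence [u :: p] of its vertices, so that its
   length is [size p]. *)
Definition kpath (D : digraph) (k : nat) (u v : D) : Prop :=
  exists p : seq D,
    [/\ path (@arc D) u p, uniq (u :: p), last u p = v & size p = k].

Definition two_anti_transitive (D : digraph) : Prop :=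
  forall u v : D, u != v -> kpath 2 u v -> ~~ arc u v.

(* The distance is a relation rather than a function: [distance u v k] holds
   for no [k] when [v] is not reachable from [u]. *)
Definition distance (D : digraph) (u v : D) (k : nat) : Prop :=
  kpath k u v /\ forall m : nat, kpath m u v -> k <= m.

(* In particular all the distances are finite; a digraph that is not strongly
   connected has no diameter in [nat]. *)
Definition diameter (D : digraph) (d : nat) : Prop :=
  (forall u v : D, exists2 k, distance u v k & k <= d) /\
  (exists u v : D, distance u v d).

Lemma dicycle3_arc_irr :
  irreflexive (fun i j : 'I_3 => val j == (val i).+1 %% 3).
Proof. by case=> [[|[|[|]]]]. Qed.

Definition dicycle3 : digraph := Digraph dicycle3_arc_irr.

(* Main.v *)
Require Import Defs.
From mathcomp Require Import all_boot.

Set Implicit Arguments.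
Unset Strict Implicit.
Unset Printing Implicit Defensive.

(** For every vertex [x] of a 2-anti-transitive digraph of diameter at most 2,
    the in-neighbourhood of [x] is independent and absorbs every vertex other
    than [x]; if [x] had an out-neighbour in it, it would absorb [x] too and so
    be a kernel. Hence a kernelless such digraph is asymmetric, and each arc
    [x -> y] lies on a directed triangle, because [y] reaches [x] in exactly two
    steps. The triangle is induced, so it has no kernel, and criticality forces
    it to be the whole digraph. *)

(* [all_boot] shadows [Defs.arc] by the sub-arc of a cycle from [path]. *)
Local Notation arc := Defs.arc.

Definition triangle (D : digraph) (x y z : D) : Prop :=
  [/\ arc x y, arc y z & arc z x] /\ [/\ ~~ arc y x, ~~ arc z y & ~~ arc x z].

Lemma triangle_rot (D : digraph) (x y z : D) :
  triangle x y z -> triangle y z x.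
Proof. by case=> [[? ? ?] [? ? ?]]. Qed.

(** A vertex [x] in [K] bars its neighbours [y] and [z] from [K]; but [z] is the only out-neighbour
    of [y], so [y] is not absorbed. *)
Lemma notin_triangle_kernel (D : digraph) (x y z : D) (K : {set D}) :
  triangle x y z -> (forall v, v \in [:: x; y; z]) -> kernel K -> x \notin K.
Proof.
move=> [[xy yz zx] [nyx _ _]] cover [indK absK]; apply/negP => xK.
have yK : y \notin K by apply/negP => yK; have := indK _ _ xK yK; rewrite xy.
have zK : z \notin K by apply/negP => zK; have := indK _ _ zK xK; rewrite zx.
have [v vK yv] := absK y yK.
have := cover v; rewrite !inE => /or3P [] /eqP E; subst v.
- by rewrite yv in nyx.
- by rewrite vK in yK.
- by rewrite vK in zK.
Qed.

Lemma triangle_no_kernel (D : digraph) (x y z : D) :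
  triangle x y z -> (forall v, v \in [:: x; y; z]) -> ~ has_kernel D.
Proof.
move=> T cover [K kerK].
(* Rotating the triangle shows that [K] is empty, and then nothing absorbs [x]. *)
have T' := triangle_rot T; have T'' := triangle_rot T'.
have xK := notin_triangle_kernel T cover kerK.
have yK : y \notin K.
  apply: (notin_triangle_kernel T') => // v.
  by have := cover v; rewrite !inE => /or3P [] ->; rewrite ?orbT.
have zK : z \notin K.
  apply: (notin_triangle_kernel T'') => // v.
  by have := cover v; rewrite !inE => /or3P [] ->; rewrite ?orbT.
have [v vK _] := kerK.2 x xK.
have := cover v; rewrite !inE => /or3P [] /eqP E; subst v.
- by rewrite vK in xK.
- by rewrite vK in yK.
- by rewrite vK in zK.
Qed.

Lemma critical_triangle_cover (D : digraph) (x y z : D) :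
  critical_kernel_imperfect D -> triangle x y z ->
  forall v, v \in [:: x; y; z].
Proof.
move=> [_ crit] T v; pose S := [set u in [:: x; y; z]].
suff /eqP ST : S == setT by have := in_setT v; rewrite -ST inE.
apply/negPn/negP => SnT; have /crit : S \proper setT by rewrite properT.
have xS : x \in S by rewrite !inE eqxx.
have yS : y \in S by rewrite !inE eqxx !orbT.
have zS : z \in S by rewrite !inE eqxx !orbT.
apply: (@triangle_no_kernel (induced S) (Sub x xS) (Sub y yS) (Sub z zS)) => //.
by move=> u; have := valP u; rewrite /S !inE.
Qed.

Lemma triangle_isomorphic (D : digraph) (x y z : D) :
  triangle x y z -> (forall v, v \in [:: x; y; z]) -> isomorphic D dicycle3.
Proof.
move=> [[xy yz zx] [nyx nzy nxz]] cover.
have neq (u v : D) : arc u v -> (u == v) = false.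
  by move=> uv; apply/negP => /eqP E; rewrite E arc_irr in uv.
pose f (v : D) : dicycle3 :=
  if v == x then @Ordinal 3 0 isT
  else if v == y then @Ordinal 3 1 isT else @Ordinal 3 2 isT.
(* Index 2 lies past the end of the list, so [nth] returns its default [z]. *)
pose g (i : dicycle3) : D := nth z [:: x; y] (val i).
have fx : f x = @Ordinal 3 0 isT by rewrite /f eqxx.
have fy : f y = @Ordinal 3 1 isT by rewrite /f eqxx eq_sym (neq _ _ xy).
have fz : f z = @Ordinal 3 2 isT.
  by rewrite /f (neq _ _ zx) eq_sym (neq _ _ yz).
exists f; split.
  exists g.
    by move=> v; have := cover v; rewrite !inE => /or3P [] /eqP ->;
      rewrite ?fx ?fy ?fz.
  by case=> [[|[|[|]]]] // i; rewrite /g /= ?fx ?fy ?fz; apply: val_inj.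
move=> u v; have := cover u; have := cover v; rewrite !inE.
by move=> /or3P [] /eqP -> /or3P [] /eqP ->; rewrite ?fx ?fy ?fz /=
  ?xy ?yz ?zx ?(negbTE nyx) ?(negbTE nzy) ?(negbTE nxz) ?arc_irr.
Qed.

(** Without loops the middle vertex differs from both ends, so distinctness reduces to [u != v]. *)
Lemma kpath2P (D : digraph) (u v : D) :
  kpath 2 u v <-> u != v /\ exists2 w, arc u w & arc w v.
Proof.
split.
  case=> [[|w [|w' [|? ?]]] [] //= /and3P [uw wv _] uniqp <- _].
  split; last by exists w.
  by move: uniqp; rewrite !inE negb_or => /andP [/andP []].
move=> [uv [w uw wv]]; exists [:: w; v]; split=> //=; first by rewrite uw wv.
rewrite !inE negb_or uv !andbT; apply/andP; split; apply/eqP => E.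
  by rewrite E arc_irr in uw.
by rewrite E arc_irr in wv.
Qed.

Lemma diameter2_two_step (D : digraph) (u v : D) :
  diameter D 2 -> u != v -> ~~ arc u v -> exists2 w, arc u w & arc w v.
Proof.
move=> [dist _] uv nuv; have [k [kp _] k2] := dist u v.
(* Distance 0 would give [u = v] and distance 1 an arc from [u] to [v], which leaves 2. *)
case: k => [|[|[|//]]] in kp k2 *; last by case/kpath2P: kp.
  by case: kp => [[|? ?] [] //= _ _ E _]; rewrite E eqxx in uv.
case: kp => [[|w [|? ?]] [] //= /andP [uw _] _ E _].
by rewrite -E uw in nuv.
Qed.

Lemma no_opposite_arcs (D : digraph) (x y : D) :
  two_anti_transitive D -> diameter D 2 -> ~ has_kernel D ->
  arc x y -> ~~ arc y x.
Proof.
move=> anti diam noker xy; apply/negP => yx; apply: noker.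
exists [set u | arc u x]; split=> [u v|u]; rewrite !inE => ux.
  (* An arc [u -> v] inside the set makes [u -> v -> x] a 2-path alongside the arc [u -> x]. *)
  move=> vx; apply/negP => uv.
  have neq : u != x by apply/eqP => E; rewrite E arc_irr in ux.
  suff : ~~ arc u x by rewrite ux.
  by apply: anti => //; apply/kpath2P; split=> //; exists v.
(* The opposite arc lets [y] absorb [x]; any other [u] outside the set is absorbed by the middle
   vertex of a 2-path to [x]. *)
have [->|neq] := eqVneq u x; first by exists y; rewrite ?inE.
by have [w uw wx] := diameter2_two_step diam neq ux; exists w; rewrite ?inE.
Qed.

Lemma dicycle3_triangle :
  @triangle dicycle3 (@Ordinal 3 0 isT) (@Ordinal 3 1 isT) (@Ordinal 3 2 isT).
Proof. by []. Qed.

Lemma dicycle3_cover (i : dicycle3) :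
  i \in [:: @Ordinal 3 0 isT; @Ordinal 3 1 isT; @Ordinal 3 2 isT].
Proof. by case: i => [[|[|[|]]]]. Qed.

Lemma dicycle3_two_anti_transitive : two_anti_transitive dicycle3.
Proof.
move=> u v _ /kpath2P [_ [w]].
by case: u v w => [[|[|[|]]] // ?] [[|[|[|]]] // ?] [[|[|[|]]] // ?].
Qed.

Lemma dicycle3_critical : critical_kernel_imperfect dicycle3.
Proof.
split; first exact: triangle_no_kernel dicycle3_triangle dicycle3_cover.
(* The sinks of a proper induced subdigraph form a kernel: if [u -> v -> w] all
   lie in [S], then [S] is everything. *)
move=> S /properP [_ [m _ mS]].
exists [set u | [forall v, ~~ @Defs.arc (induced S) u v]].
split=> [u v|u]; rewrite !inE.
  by move=> /forallP /(_ v).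
move=> /forallPn [v]; rewrite negbK => uv; exists v => //.
rewrite inE; apply/forallP => w; apply/negP => vw.
(* The vertex [m] outside [S] differs from [u], [v] and [w], but [u -> v -> w] already runs through
   all three residues. *)
have neq (t : induced S) : val m != val (val t).
  by apply: contraNneq mS => /val_inj ->; exact: valP.
move: (neq u) (neq v) (neq w) uv vw; rewrite /=.
move: (val u) (val v) (val w) => {}u {}v {}w.
by case: m u v w {mS neq} => [[|[|[|]]] // ?] [[|[|[|]]] // ?]
  [[|[|[|]]] // ?] [[|[|[|]]] // ?].
Qed.

Lemma dicycle3_diameter : diameter dicycle3 2.
Proof.
have far (u v : dicycle3) : u != v -> ~~ arc u v -> distance u v 2.
  move=> uv nuv; split.
    apply/kpath2P; split=> //.
    (* A vertex other than [u] and its successor is the successor of that successor. *)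
    exists (@Ordinal 3 ((val u).+1 %% 3) (@ltn_pmod _ 3 isT));
      by case: u v uv nuv => [[|[|[|]]] // ?] [[|[|[|]]] // ?].
  move=> [|[|?]] [[|w [|? ?]]] [] //= => [_ _ E _|/andP [uw _] _ E _].
    by rewrite E eqxx in uv.
  by case/negP: nuv; rewrite -E.
split; last by exists (@Ordinal 3 1 isT), (@Ordinal 3 0 isT); apply: far.
move=> u v; have [<-|uv] := eqVneq u v.
  by exists 0 => //; split=> //; exists [::].
have [auv|nuv] := boolP (arc u v); last by exists 2 => //; apply: far.
exists 1 => //; split.
  exists [:: v]; split=> //; first by apply/andP.
  by rewrite cons_uniq mem_seq1 uv.
by move=> [|?] [[|? ?] [] //= _ _ E _]; rewrite E eqxx in uv.
Qed.

Theorem theorem28 :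
  [/\ two_anti_transitive dicycle3,
      critical_kernel_imperfect dicycle3
    & diameter dicycle3 2] /\
  (forall D : digraph,
     two_anti_transitive D -> critical_kernel_imperfect D -> diameter D 2 ->
     isomorphic D dicycle3).
Proof.
split.
  split; [exact: dicycle3_two_anti_transitive | exact: dicycle3_critical |].
  exact: dicycle3_diameter.
move=> D anti crit diam; have noker := crit.1.
have asym (u v : D) : arc u v -> ~~ arc v u by exact: no_opposite_arcs.
(* The first arc of a path realising the diameter serves as [x -> y]. *)
have [_ [x [t [/kpath2P [_ [y xy _]] _]]]] := diam.
have yx : y != x by apply/eqP => E; rewrite E arc_irr in xy.
have [z yz zx] := diameter2_two_step diam yx (asym _ _ xy).
have T : triangle x y z by split; split=> //; apply: asym.
exact: triangle_isomorphic T (critical_triangle_cover crit T).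
Qed.
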